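(* For every integer $r\ge 7$ and every graph $G$ of maximum degree $\Delta\ge 3$, the $(\Delta+1)$-colorings of $G$ are $r$-safe. That is: for every vertex $v$ and every proper $(\Delta+1)$-coloring of $G$ in which $v$ is non-frozen, and for every vertex $w$ at distance exactly $r$ from $v$, there exists a sequence of single vertex recolorings (through proper $(\Delta+1)$-colorings) such that $w$ is recolored, every other recolored vertex lies in $B(v,r-1)$, and $v$ is non-frozen at the end of the sequence.
   Context: A vertex $u$ is frozen in a proper $(\Delta+1)$-coloring if all $\Delta+1$ colors appear on its closed neighborhood $N[u]$. $B(v,s)$ denotes the set of vertices at distance at most $s$ from $v$. A single vertex recoloring changes the color of one vertex so that the coloring remains proper. *)

(* Defs.v *)
From mathcomp Require Import all_boot.
Set Implicit Arguments.
Unset Strict Implicit.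
Unset Printing Implicit Defensive.

(** A finite simple graph is a symmetric irreflexive [e : rel T] on a finite
    type [T] (the two properties are hypotheses of the theorem). *)

Definition nbhd (T : finType) (e : rel T) (x : T) : {set T} := [set y | e x y].

Definition closed_nbhd (T : finType) (e : rel T) (x : T) : {set T} :=
  x |: nbhd e x.

Definition max_degree (T : finType) (e : rel T) : nat :=
  \max_(x : T) #|nbhd e x|.

(** [k.-bseq T] is the type of sequences of length at most [k]; [path e x p]
    has [size p] edges. No value is attached to unreachable pairs: they are at
    distance at most [k] for no [k]. *)
Definition dist_le (T : finType) (e : rel T) (x y : T) (k : nat) : bool :=
  [exists p : k.-bseq T, path e x p && (last x p == y)].

Definition dist_eq (T : finType) (e : rel T) (x y : T) (k : nat) : bool :=
  dist_le e x y k && [forall j : 'I_k, ~~ dist_le e x y j].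

Definition ball (T : finType) (e : rel T) (v : T) (s : nat) : {set T} :=
  [set x | dist_le e v x s].

Definition proper (T : finType) (e : rel T) (k : nat)
    (c : {ffun T -> 'I_k}) : bool :=
  [forall x, forall y, e x y ==> (c x != c y)].

Definition frozen (T : finType) (e : rel T) (k : nat)
    (c : {ffun T -> 'I_k}) (x : T) : bool :=
  [forall a : 'I_k, exists y in closed_nbhd e x, c y == a].

Definition recolors (T : finType) (e : rel T) (k : nat) (x : T)
    (c c' : {ffun T -> 'I_k}) : bool :=
  [&& proper e c', c' x != c x & [forall y, (y != x) ==> (c' y == c y)]].

Definition step_in (T : finType) (e : rel T) (k : nat) (A : {set T})
    (c c' : {ffun T -> 'I_k}) : bool :=
  [exists x in A, recolors e x c c'].

(** The sequence of recolorings is given by its successive colorings [cs].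
    "[w] is recolored" is read on the whole sequence: the final color of [w]
    differs from its initial one. Asking only that some step recolors [w] would
    make the last clause void, as one could then undo the whole sequence and
    return to [c]. *)
Definition safe (T : finType) (e : rel T) (k r : nat) : Prop :=
  forall (v : T) (c : {ffun T -> 'I_k}),
    proper e c -> ~~ frozen e c v ->
  forall w : T, dist_eq e v w r ->
  exists cs : seq {ffun T -> 'I_k},
    [/\ path (step_in e (w |: ball e v r.-1)) c cs,
        last c cs w != c w
      & ~~ frozen e (last c cs) v].

(* Main.v *)
(**
  A frozen vertex has degree [Delta] and a rainbow closed neighborhood, so
  recoloring a vertex unfreezes its frozen neighbors. Hence a non-frozen vertex
  can send a "token" along any simple path and get its last vertex recolored
  ([token_path]). If this can be done from a vertex at distance at least 2 from
  [v], inside the ball and away from [N[v]], then [v] stays non-frozen and we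
  are done. So let all the vertices that matter be frozen. A token coming from
  [v] can then swap the colors of an edge [x y] far from [v] and afterwards
  retrace its path, provided that [y] does not have the color of the vertex
  three steps earlier. A neighbor of [x] that is not a neighbor of [y] is now
  non-frozen, and sends a token to [w].
  It remains to find such an edge along a geodesic [u 0 = v, ..., u r = w]. The
  edge from [u 4] to [u 5] works unless [u 2] and [u 5] have the same color;
  then take a third neighbor [y] of [u 4]. Either the edge from [u 4] to [y]
  works, or [y] gives an alternative geodesic through [y] in place of [u 3] or
  [u 4], with a different color there, and the edge after it, from [u 5] to
  [u 6] or from [u 6] to [u 7], can be swapped via one of the two geodesics.
*)
Require Import Defs.
From mathcomp Require Import all_boot perm.
Set Implicit Arguments.
Unset Strict Implicit.
Unset Printing Implicit Defensive.

(** * Frozen vertices and rainbow neighborhoods *)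

Section Recoloring.

Context (T : finType) (e : rel T) (Delta : nat).
Hypothesis e_sym : symmetric e.
Hypothesis e_irr : irreflexive e.
Hypothesis deg_le : forall x, #|nbhd e x| <= Delta.

Local Notation coloring := {ffun T -> 'I_Delta.+1}.
Local Notation proper := (Defs.proper e).
Local Notation "N[ x ]" := (closed_nbhd e x).

Implicit Types (c d : coloring) (x y z s t u : T) (a b : 'I_Delta.+1).

Lemma in_closed_nbhd x y : (y \in N[x]) = (y == x) || e x y.
Proof. by rewrite !inE. Qed.

Lemma properP c : reflect (forall x y, e x y -> c x != c y) (proper c).
Proof.
apply: (iffP forallP) => [H x y exy | H x]; last first.
  by apply/forallP=> y; apply/implyP/H.
by move/forallP: (H x) => /(_ y); rewrite exy.
Qed.

Definition missing c x a := [forall z in N[x], c z != a].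

Lemma missingP c x a :
  reflect (forall z, z \in N[x] -> c z != a) (missing c x a).
Proof. exact: forall_inP. Qed.

Lemma nonfrozenP c x : reflect (exists a, missing c x a) (~~ frozen e c x).
Proof.
rewrite /frozen negb_forall; apply: (iffP existsP) => -[a Ha]; exists a.
  by rewrite negb_exists_in in Ha.
by rewrite negb_exists_in.
Qed.

Lemma eq_frozen c d x : {in N[x], c =1 d} -> frozen e c x = frozen e d x.
Proof.
move=> cd; apply: eq_forallb => a; apply: eq_existsb => z.
by case zx: (z \in N[x]) => //=; rewrite cd.
Qed.

Lemma card_closed_nbhd x : #|N[x]| = #|nbhd e x|.+1.
Proof. by rewrite /closed_nbhd cardsU1 !inE e_irr. Qed.

Lemma frozen_imset c x : frozen e c x -> c @: N[x] = setT.
Proof.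
move/forallP=> fx; apply/setP=> a; rewrite inE.
by have /exists_inP[y yx /eqP <-] := fx a; apply: imset_f.
Qed.

(** [Delta.+1] colors occur on at most [Delta.+1] vertices, so none repeats. *)
Lemma frozen_inj c x : frozen e c x -> {in N[x] &, injective c}.
Proof.
move=> fx; apply/imset_injP; rewrite eqn_leq leq_imset_card /=.
by rewrite frozen_imset // cardsT card_ord card_closed_nbhd ltnS.
Qed.

Lemma frozen_degree c x : frozen e c x -> #|nbhd e x| = Delta.
Proof.
move=> fx; apply/eqP; rewrite eqn_leq deg_le -ltnS -card_closed_nbhd.
by rewrite -[X in X <= _]card_ord -cardsT -(frozen_imset fx) leq_imset_card.
Qed.

Lemma frozen_third_nbr c x y z :
  3 <= Delta -> frozen e c x -> exists2 t, e x t & (t != y) && (t != z).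
Proof.
move=> D3 fx; have: 0 < #|nbhd e x :\ y :\ z|.
  have := cardsD1 y (nbhd e x); have := cardsD1 z (nbhd e x :\ y).
  rewrite (frozen_degree fx) => E2 E1; move: D3; rewrite E1 E2.
  by case: (_ \in _); case: (_ \in _); case: #|_|.
by case/card_gt0P=> t; rewrite !inE => /and3P[tz ty xt]; exists t; rewrite ?ty.
Qed.

(** * Recoloring one vertex *)

Definition recolor c x a : coloring := [ffun z => if z == x then a else c z].

Lemma recolor_self c x a : recolor c x a x = a.
Proof. by rewrite ffunE eqxx. Qed.

Lemma recolor_other c x a z : z != x -> recolor c x a z = c z.
Proof. by rewrite ffunE => /negPf->. Qed.

Lemma recolorK c x a : recolor (recolor c x a) x (c x) = c.
Proof. by apply/ffunP=> z; rewrite !ffunE; case: eqP => // ->. Qed.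

Lemma recolor_proper c x a : proper c -> missing c x a -> proper (recolor c x a).
Proof.
move=> /properP pc /missingP ma; apply/properP=> s t est; rewrite !ffunE.
case: (s =P x) => [sx|_]; case: (t =P x) => [tx|_]; last exact: pc.
- by rewrite sx tx e_irr in est.
- by rewrite eq_sym ma // in_closed_nbhd -sx est orbT.
- by rewrite ma // in_closed_nbhd -tx e_sym est orbT.
Qed.

Lemma frozen_recolor c x a z :
  x \notin N[z] -> frozen e (recolor c x a) z = frozen e c z.
Proof.
move=> xz; apply: eq_frozen => t tz; apply: recolor_other.
by apply: contraNneq xz => <-.
Qed.

(** In the rainbow set [N[y]] only [x] had color [c x], so giving it up frees it at [y]. *)
Lemma missing_recolor c x y a :
  frozen e c y -> e x y -> a != c x -> missing (recolor c x a) y (c x).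
Proof.
move=> fy exy ax; apply/missingP=> z zy; rewrite ffunE; have [//|zx] := eqVneq z x.
apply: contraNneq zx => /(frozen_inj fy) -> //.
by rewrite in_closed_nbhd e_sym exy orbT.
Qed.

(** * Recoloring sequences inside a vertex set [A] *)

Section Reachability.

Variable A : {set T}.

Local Notation reach := (connect (step_in e (k := Delta.+1) A)).

Lemma reach_recolor c x a :
  x \in A -> proper (recolor c x a) -> reach c (recolor c x a).
Proof.
move=> xA pr; have [ax|ax] := eqVneq a (c x).
  suff ->: recolor c x a = c by [].
  by apply/ffunP=> z; rewrite ffunE ax; case: eqP => // ->.
apply/connect1/exists_inP; exists x => //; apply/and3P; split=> //.
  by rewrite recolor_self.
by apply/forallP=> z; apply/implyP=> zx; rewrite recolor_other.
Qed.

Lemma reach_recolorV c x a :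
  x \in A -> proper c -> reach (recolor c x a) c.
Proof.
by move=> xA pc; rewrite -[X in reach _ X](recolorK c x a) reach_recolor ?recolorK.
Qed.

(** Only a frozen next vertex forces a move. Since the path is simple, its last vertex is untouched
    until the token arrives. *)
Lemma token_path p x c :
    proper c -> ~~ frozen e c x -> path e x p -> uniq (x :: p) ->
    {subset x :: p <= A} ->
  exists d, [/\ reach c d, d (last x p) != c (last x p) &
              forall z, z \notin x :: p -> d z = c z].
Proof.
elim: p x c => [|y p IH] x c pc nfx.
  move=> _ _ sA; have /nonfrozenP[a ma] := nfx; exists (recolor c x a); split.
  - by apply: reach_recolor; [apply/sA/mem_head | apply: recolor_proper].
  - by rewrite /= recolor_self eq_sym (missingP _ _ _ ma) // in_closed_nbhd eqxx.
  - by move=> z; rewrite inE; apply: recolor_other.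
rewrite /= => /andP[exy pp] /and3P[xyp yp up] sA.
have sA' : {subset y :: p <= A} by move=> z zp; apply: sA; rewrite inE zp orbT.
have up' : uniq (y :: p) by rewrite /= yp.
case: (boolP (frozen e c y)) => [fy|nfy]; last first.
  have [d [cd dl dz]] := IH y c pc nfy pp up' sA'.
  by exists d; split=> // z; rewrite inE negb_or => /andP[_ /dz].
have /nonfrozenP[a ma] := nfx.
have pc' := recolor_proper pc ma.
have nax : a != c x by rewrite eq_sym (missingP _ _ _ ma) // in_closed_nbhd eqxx.
have nfy' : ~~ frozen e (recolor c x a) y.
  by apply/nonfrozenP; exists (c x); apply: missing_recolor.
have [d [cd dl dz]] := IH y _ pc' nfy' pp up' sA'.
exists d; split.
- by apply: connect_trans cd; apply: reach_recolor => //; apply/sA/mem_head.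
- rewrite recolor_other // in dl.
  by apply: contraNneq xyp => <-; apply: mem_last.
- move=> z; rewrite inE negb_or => /andP[zx zp].
  by rewrite dz // recolor_other.
Qed.


(** * Swapping the colors of an edge *)

Definition swap c x y : coloring := [ffun z => c (tperm x y z)].

Lemma swap_other c x y z : z != x -> z != y -> swap c x y z = c z.
Proof. by move=> zx zy; rewrite ffunE tpermD // eq_sym. Qed.

Lemma swapl c x y : swap c x y x = c y.
Proof. by rewrite ffunE tpermL. Qed.

Lemma swapr c x y : swap c x y y = c x.
Proof. by rewrite ffunE tpermR. Qed.

(** The color [c y] received by [x] occurs in the rainbow set [N[x]] only at [y], and
    symmetrically. *)
Lemma swap_proper c x y :
  proper c -> e x y -> frozen e c x -> frozen e c y -> proper (swap c x y).
Proof.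
move=> /properP pc exy /frozen_inj ix /frozen_inj iy; apply/properP.
have swap_nbr s t z : e s t -> {in N[s] &, injective c} -> e s z -> z != t ->
    c t != c z.
  move=> est is_ esz; apply: contraNneq => ctz; apply/eqP/is_ => //;
  by rewrite in_closed_nbhd ?est ?esz orbT.
have eyx : e y x by rewrite e_sym.
have xNy : x != y by apply: contraTneq exy => ->; rewrite e_irr.
suff half s t : s = x \/ s = y -> e s t -> swap c x y s != swap c x y t.
  move=> s t est; have [sx|sx] := eqVneq s x; first by apply: half => //; left.
  have [sy|sy] := eqVneq s y; first by apply: half => //; right.
  have [tx|tx] := eqVneq t x; first by rewrite eq_sym half 1?e_sym //; left.
  have [ty|ty] := eqVneq t y; first by rewrite eq_sym half 1?e_sym //; right.
  by rewrite !swap_other // pc.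
case=> -> est.
- rewrite swapl; have [->|ty] := eqVneq t y; first by rewrite swapr pc.
  rewrite swap_other ?(swap_nbr x) //.
  by apply: contraTneq est => ->; rewrite e_irr.
- rewrite swapr; have [->|tx] := eqVneq t x; first by rewrite swapl pc.
  rewrite swap_other ?(swap_nbr y) //.
  by apply: contraTneq est => ->; rewrite e_irr.
Qed.

(** Five moves: [t] takes [a], [x] takes [c t], [y] takes [c x], [x] takes [c y], and [t] returns to
    [c t]. As [t] holds [a] when [x] takes [c y], these two colors must differ. *)
Lemma reach_swap_edge c t x y a :
    proper c -> t \in A -> x \in A -> y \in A -> e t x -> e x y -> t != y ->
    frozen e c x -> frozen e c y -> missing c t a -> a != c y ->
  reach c (swap c x y).
Proof.
move=> pc tA xA yA etx exy tNy fx fy mt aNy.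
have [ix iy] := (frozen_inj fx, frozen_inj fy).
have Nxx : x \in N[x] by rewrite in_closed_nbhd eqxx.
have Nyy : y \in N[y] by rewrite in_closed_nbhd eqxx.
have Nxt : t \in N[x] by rewrite in_closed_nbhd e_sym etx orbT.
have Nxy : y \in N[x] by rewrite in_closed_nbhd exy orbT.
have Nyx : x \in N[y] by rewrite in_closed_nbhd e_sym exy orbT.
have tNx : t != x by apply: contraTneq etx => ->; rewrite e_irr.
have xNy : x != y by apply: contraTneq exy => ->; rewrite e_irr.
have cE z s t' : {in N[z] &, injective c} -> s \in N[z] -> t' \in N[z] ->
    s != t' -> c s != c t'.
  by move=> iz sz tz; apply: contraNneq => /iz ->.
have aNt : a != c t by rewrite eq_sym (missingP _ _ _ mt) // in_closed_nbhd eqxx.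
have aNx : a != c x.
  by rewrite eq_sym (missingP _ _ _ mt) // in_closed_nbhd etx orbT.
set c1 := recolor c t a; set c2 := recolor c1 x (c t).
set c3 := recolor c2 y (c x); set c4 := recolor c3 x (c y).
have p1 : proper c1 by apply: recolor_proper.
have p2 : proper c2 by apply: recolor_proper => //; apply: missing_recolor.
have p3 : proper c3.
  apply: recolor_proper => //; apply/missingP=> z zy; rewrite !ffunE.
  have [_|zx] := eqVneq z x; first exact: (cE x).
  by case: (z =P t) => // _; apply: (cE y).
have p4 : proper c4.
  apply: recolor_proper => //; apply/missingP=> z zx; rewrite !ffunE.
  have [_|zy] := eqVneq z y; first exact: (cE x).
  have [_|zNx] := eqVneq z x; first exact: (cE x).
  by case: (z =P t) => // _; apply: (cE x).
have swapE : swap c x y = recolor c4 t (c t).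
  apply/ffunP=> z; rewrite !ffunE.
  have [->|zt] := eqVneq z t; first by rewrite tpermD // eq_sym.
  have [->|zx] := eqVneq z x; first by rewrite tpermL.
  have [->|zy] := eqVneq z y; first by rewrite tpermR.
  by rewrite tpermD // eq_sym.
have p5 := swap_proper pc exy fx fy.
apply: (@connect_trans _ _ c1); first exact: reach_recolor.
apply: (@connect_trans _ _ c2); first exact: reach_recolor.
apply: (@connect_trans _ _ c3); first exact: reach_recolor.
apply: (@connect_trans _ _ c4); first exact: reach_recolor.
by rewrite swapE in p5 *; apply: reach_recolor.
Qed.

(* Conjugation by token moves: a recoloring of a vertex away from [x] and [y]
   commutes with the swap. *)
Lemma reach_swap_recolor c x y z a :
    z \in A -> z != x -> z != y -> proper (recolor c z a) ->
    proper (swap c x y) ->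
    reach (recolor c z a) (swap (recolor c z a) x y) ->
  reach c (swap c x y).
Proof.
move=> zA zx zy pr ps swap_zr; apply: connect_trans (reach_recolor zA pr) _.
apply: connect_trans swap_zr _.
suff ->: swap (recolor c z a) x y = recolor (swap c x y) z a.
  exact: reach_recolorV.
apply/ffunP=> u; rewrite !ffunE; have [->|uz] := eqVneq u z.
  by rewrite tpermD ?eqxx // eq_sym.
case: tpermP => [_ | _ | _ _]; last by rewrite (negPf uz).
- by rewrite eq_sym (negPf zy).
- by rewrite eq_sym (negPf zx).
Qed.

(* The token travels to [t], which then misses the original color of [s]. *)
Lemma reach_swap_path p c s t x y :
    proper c -> ~~ frozen e c (head s p) ->
    path e (head s p) (behead (rcons p s)) -> e s t -> e t x -> e x y -> t != y ->
    {in rcons p s, forall z, [/\ z \in A, z \notin N[x] & z \notin N[y]]} ->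
    {in p, forall z, z \notin N[t] /\ z != s} ->
    t \in A -> x \in A -> y \in A ->
    frozen e c t -> frozen e c x -> frozen e c y -> c s != c y ->
  reach c (swap c x y).
Proof.
elim: p c => [|z p IH] c pc nf /= ppath est etx exy tNy Nxy Nt tA xA yA ft fx fy csy.
  have /nonfrozenP[a ma] := nf.
  have [sA sx sy] : [/\ s \in A, s \notin N[x] & s \notin N[y]].
    by apply: Nxy; rewrite mem_head.
  have [sNx sNy] : s != x /\ s != y.
    by split; [move: sx|move: sy]; rewrite in_closed_nbhd negb_or => /andP[].
  have pc' := recolor_proper pc ma.
  have aNs : a != c s by rewrite eq_sym (missingP _ _ _ ma) // in_closed_nbhd eqxx.
  apply: (reach_swap_recolor sA sNx sNy pc'); first exact: swap_proper.
  apply: (reach_swap_edge (t := t) (a := c s)); rewrite ?frozen_recolor //.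
    exact: missing_recolor.
  by rewrite recolor_other // eq_sym.
have [zA zx zy] : [/\ z \in A, z \notin N[x] & z \notin N[y]].
  by apply: Nxy; rewrite mem_head.
have [zt zs] := Nt z (mem_head _ _).
have Nxy' : {in rcons p s, forall z, [/\ z \in A, z \notin N[x] & z \notin N[y]]}.
  by move=> u up; apply: Nxy; rewrite inE up orbT.
have Nt' : {in p, forall z, z \notin N[t] /\ z != s}.
  by move=> u up; apply: Nt; rewrite inE up orbT.
have [ezp pp] : e z (head s p) /\ path e (head s p) (behead (rcons p s)).
  by case: (p) ppath => [|u q] /= /andP[].
(* A non-frozen next vertex can start the token itself, leaving [z] alone. *)
case: (boolP (frozen e c (head s p))) => [fh|nfh]; last exact: IH.
have /nonfrozenP[a ma] := nf.
have pc' := recolor_proper pc ma.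
have aNz : a != c z by rewrite eq_sym (missingP _ _ _ ma) // in_closed_nbhd eqxx.
have [zNx zNy] : z != x /\ z != y.
  by split; [move: zx|move: zy]; rewrite in_closed_nbhd negb_or => /andP[].
(* [z] lies outside [N[t]], [N[x]] and [N[y]], so recoloring it keeps these three vertices
   frozen. *)
apply: (reach_swap_recolor zA zNx zNy pc'); first exact: swap_proper.
apply: IH => //; rewrite ?(frozen_recolor _ _ zt) ?(frozen_recolor _ _ zx)
  ?(frozen_recolor _ _ zy) //.
  by apply/nonfrozenP; exists (c z); apply: missing_recolor.
by rewrite !recolor_other // eq_sym.
Qed.

(** * Tokens and swaps along a geodesic *)

Section Geodesic.

(** [f] abstracts the distance from [v]: it rises by at most one along an edge, and [u] climbs one
    level at a time. *)
Variables (r : nat) (f : T -> nat) (u : nat -> T) (v : T) (c : coloring).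
Hypothesis f_lip : forall s t, e s t -> f t <= (f s).+1.
Hypothesis f_in : forall z, f z < r -> z \in A.
Hypothesis ur_in : u r \in A.
Hypothesis f_v : f v = 0.
Hypothesis f_u : forall i, i <= r -> f (u i) = i.
Hypothesis e_u : forall i, i < r -> e (u i) (u i.+1).
Hypothesis u0 : u 0 = v.
Hypothesis c_proper : proper c.
Hypothesis v_nonfrozen : ~~ frozen e c v.

Definition can_recolor_end :=
  exists d, [/\ reach c d, d (u r) != c (u r) & ~~ frozen e d v].

Lemma u_in i : i <= r -> u i \in A.
Proof. by rewrite leq_eqVlt => /predU1P[-> //|ir]; apply: f_in; rewrite f_u // ltnW. Qed.

Lemma notin_nbhd s t : (f s).+1 < f t -> s \notin N[t].
Proof.
move=> fst; rewrite in_closed_nbhd negb_or; apply/andP; split.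
  by apply: contraTneq fst => ->; rewrite ltnNge leqnSn.
by apply: contraTN fst => ets; rewrite -leqNgt f_lip // e_sym.
Qed.

Lemma closed_nbhdC s t : (s \in N[t]) = (t \in N[s]).
Proof. by rewrite !in_closed_nbhd eq_sym e_sym. Qed.

Lemma f_nbhd_v z : z \in N[v] -> f z <= 1.
Proof.
by rewrite in_closed_nbhd => /orP[/eqP->|/f_lip]; rewrite f_v.
Qed.

Lemma u_path i m : i + m <= r -> path e (u i) [seq u j | j <- iota i.+1 m].
Proof.
elim: m i => //= m IH i; rewrite addnS -addSn => imr.
by rewrite IH // e_u // (leq_trans _ imr) // leq_addr.
Qed.

Lemma u_last i m : last (u i) [seq u j | j <- iota i.+1 m] = u (i + m).
Proof. by elim: m i => [|m IH] i /=; rewrite ?addn0 // IH addnS addSn. Qed.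

Lemma u_uniq i m : i + m <= r.+1 -> uniq [seq u j | j <- iota i m].
Proof.
move=> imr; rewrite map_inj_in_uniq ?iota_uniq // => j k.
rewrite !mem_iota => /andP[_ jr] /andP[_ kr] /(congr1 f).
by rewrite !f_u // -ltnS (leq_trans _ imr).
Qed.

(** [N[v]] lies in levels 0 and 1, so a token kept above level 1 leaves its colors unchanged. *)
Lemma recolor_end_path d z q :
    reach c d -> proper d -> d (u r) = c (u r) -> ~~ frozen e d v ->
    ~~ frozen e d z -> path e z q -> uniq (z :: q) -> last z q = u r ->
    {in z :: q, forall t, t \in A /\ 1 < f t} ->
  can_recolor_end.
Proof.
move=> cd pd dw nfv nfz pq uq lq Hq.
have [|d' [dd' d'w d'E]] := token_path pd nfz pq uq; first by move=> t /Hq[].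
exists d'; split; first exact: connect_trans dd'.
  by rewrite -dw -lq.
rewrite (@eq_frozen d' d) // => t tv; apply: d'E; apply: contraTN (f_nbhd_v tv).
by rewrite -ltnNge => /Hq[].
Qed.

Lemma recolor_end_u d i :
    reach c d -> proper d -> d (u r) = c (u r) -> ~~ frozen e d v ->
    1 < i <= r -> ~~ frozen e d (u i) ->
  can_recolor_end.
Proof.
move=> cd pd dw nfv /andP[i1 ir] nfi; have iE : i + (r - i) = r by rewrite subnKC.
apply: (recolor_end_path (q := [seq u j | j <- iota i.+1 (r - i)])
  cd pd dw nfv nfi).
- by apply: u_path; rewrite iE.
- by apply: (@u_uniq i (r - i).+1); rewrite addnS iE.
- by rewrite u_last iE.
- move=> t /(mapP (s := iota i (r - i).+1))[j].
  rewrite mem_iota addnS iE ltnS => /andP[ij jr] ->.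
  by rewrite u_in // f_u // (leq_trans i1).
Qed.

(** A frozen [u i] sees color [c x] only at [x]. The swap moves that color to [y], outside [N[u i]],
    so [u i] can now send a token. *)
Lemma recolor_end_swap i x y :
    reach c (swap c x y) -> frozen e c x -> frozen e c y -> e x y ->
    1 < f x -> 1 < f y -> 1 < i <= r -> e (u i) x -> u i \notin N[y] ->
  can_recolor_end.
Proof.
move=> cs fx fy exy f1x f1y ir eux Nuy.
case: (boolP (frozen e c (u i))) => [fi|]; last first.
  exact: (recolor_end_u (connect0 _ _) c_proper (erefl _) v_nonfrozen).
have cxy : c x != c y by apply: (properP _ c_proper).
have nfv : ~~ frozen e (swap c x y) v.
  rewrite (@eq_frozen _ c) // => t /f_nbhd_v ft; apply: swap_other.
    by apply: contraTneq ft => ->; rewrite -ltnNge.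
  by apply: contraTneq ft => ->; rewrite -ltnNge.
(* If [u r] is on the swapped edge, the swap has already recolored it. *)
have [urx|urx] := eqVneq (u r) x.
  by exists (swap c x y); split; rewrite // urx swapl eq_sym.
have [ury|ury] := eqVneq (u r) y.
  by exists (swap c x y); split; rewrite // ury swapr.
apply: recolor_end_u cs _ _ nfv ir _; [exact: swap_proper | exact: swap_other |].
apply/nonfrozenP; exists (c x); apply/missingP => z zi.
have zNy : z != y by apply: contraNneq Nuy => <-; rewrite closed_nbhdC.
have [->|zx] := eqVneq z x; first by rewrite swapl eq_sym.
rewrite swap_other //; apply: contraNneq zx => /(frozen_inj fi) -> //.
by rewrite in_closed_nbhd eux orbT.
Qed.

(** The token runs through [u 0, ..., u i.-1, s, u i.+1], where [s] may differ from [u i]. Vertices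
    below level [i] are too low to meet [N[y]], but [s] could be adjacent to [y], hence its own
    hypothesis. *)
Lemma reach_swap_geodesic i s y :
    0 < i -> i.+2 <= r -> f s = i -> e (u i.-1) s -> e s (u i.+1) ->
    e (u i.+2) y -> y \in A -> y \notin N[s] -> i < f y ->
    frozen e c (u i.+1) -> frozen e c (u i.+2) -> frozen e c y -> c s != c y ->
  reach c (swap c (u i.+2) y).
Proof.
(* From here [i] is one less than in the statement: [u 0, ..., u i] precede [s]. *)
case: i => // i _ ir fs eus esu euy yA yNs fy ft fx fyy csy.
have pE z : z \in [seq u j | j <- iota 0 i.+1] -> f z < i.+1 /\ z \in A.
  case/mapP=> j; rewrite mem_iota => /andP[_ ji] ->.
  have jr : j <= r by rewrite (leq_trans _ ir) // ltnW // ltnW // ltnW.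
  by rewrite f_u // u_in.
apply: (@reach_swap_path [seq u j | j <- iota 0 i.+1] _ s (u i.+2)) => //.
- by rewrite /= u0.
- rewrite /= rcons_path u_last add0n eus andbT u_path // add0n.
  by rewrite (leq_trans _ ir) // ltnW // ltnW.
- by apply: e_u.
- by apply: contraNneq yNs => <-; rewrite in_closed_nbhd esu orbT.
- move=> z; rewrite mem_rcons inE => /predU1P[->|/pE[fz zA]].
    split; first by apply: f_in; rewrite fs ltnW.
      by apply: notin_nbhd; rewrite fs f_u.
    by rewrite closed_nbhdC.
  by split=> //; apply: notin_nbhd; rewrite ?f_u // (leq_ltn_trans fz) // ltnW.
- move=> z /pE[fz _]; split; first by apply: notin_nbhd; rewrite f_u // ltnW.
  by apply: contraTneq fz => ->; rewrite fs ltnn.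
- by rewrite u_in // ltnW.
- by rewrite u_in.
Qed.

Lemma recolor_end : 3 <= Delta -> 6 < r -> can_recolor_end.
Proof.
move=> D3 r7.
have le_r i : i < 8 -> i <= r by move=> i8; apply: leq_trans r7.
(* A non-frozen [u i] above level 1 already finishes. Index 7 serves the edge from [u 6] to
   [u 7]. *)
have fr i : 1 < i -> i < 8 -> frozen e c (u i) \/ can_recolor_end.
  move=> i1 i8; case: (boolP (frozen e c (u i))) => [|nf]; first by left.
  by right; apply: (recolor_end_u _ c_proper _ v_nonfrozen _ nf);
      rewrite ?connect0 // i1 le_r.
have [fr3|//] := fr 3 isT isT; have [fr4|//] := fr 4 isT isT.
have [fr5|//] := fr 5 isT isT; have [fr6|//] := fr 6 isT isT.
have [fr7|//] := fr 7 isT isT.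
have fuE i : i < 8 -> f (u i) = i by move=> i8; rewrite f_u // le_r.
have euE i : i < 7 -> e (u i) (u i.+1) by move=> i7; rewrite e_u // (leq_trans i7).
have uA i : i < 8 -> u i \in A by move=> i8; rewrite u_in // le_r.
(* Of two vertices [u i] and [y] with common neighbors [u i.-1] and [u i.+1],
   one has a color different from that of [u i.+3]. *)
have diamond i y : 1 < i -> i < 5 -> e (u i.-1) y -> e y (u i.+1) -> f y = i ->
    frozen e c (u i.+1) -> frozen e c (u i.+2) -> frozen e c (u i.+3) ->
    c y != c (u i) -> can_recolor_end.
  move=> i1 i5 euy eyu fy fi1 fi2 fi3 cyu.
  have i8 k : k < 4 -> i + k < 8.
    by move=> k4; rewrite (@leq_ltn_trans (4 + k)) ?leq_add2r // (ltn_add2l 4 k 4).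
  have i81 : i.+1 < 8 by rewrite -addn1 i8.
  have i82 : i.+2 < 8 by rewrite -addn2 i8.
  have i83 : i.+3 < 8 by rewrite -addn3 i8.
  have [s [fs eus esu csx]] : exists s, [/\ f s = i, e (u i.-1) s, e s (u i.+1)
      & c s != c (u i.+3)].
    have [cy|cy] := eqVneq (c y) (c (u i.+3)); last by exists y.
    exists (u i); rewrite -cy eq_sym cyu fuE ?(ltn_trans i5) //.
    by split=> //; [case: (i) i1 i5 => // j _ j5; rewrite euE // ltnW // ltnW // ltnW
      | rewrite euE // (ltn_trans i5)].
  (* Swap the edge from [u i.+2] to [u i.+3] through [s]; then [u i.+1], two levels below [u i.+3],
     sends the token. *)
  apply: (recolor_end_swap (i := i.+1) (x := u i.+2) (y := u i.+3)) => //;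
    rewrite ?fuE ?euE ?le_r ?ltnS ?(ltnW i1) //.
    apply: reach_swap_geodesic csx; rewrite ?le_r ?euE ?uA ?fuE //.
      by rewrite ltnW.
      by rewrite closed_nbhdC; apply: notin_nbhd; rewrite fs fuE.
    by rewrite ltnW.
  by apply: notin_nbhd; rewrite !fuE.
(* If the colors differ, swap the edge from [u 4] to [u 5]; the final token leaves from [u 3]. *)
have [c25|c25] := eqVneq (c (u 2)) (c (u 5)); last first.
  apply: (recolor_end_swap (i := 3) (x := u 4) (y := u 5)); rewrite ?fuE ?euE ?le_r //.
    apply: reach_swap_geodesic c25; rewrite ?le_r ?euE ?uA ?fuE //.
    by rewrite closed_nbhdC; apply: notin_nbhd; rewrite !fuE.
  by apply: notin_nbhd; rewrite !fuE.
have [y eu4y /andP[y3 y5]] := frozen_third_nbr (u 3) (u 5) D3 fr4.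
(* As a neighbor of [u 4], [y] has level 3, 4 or 5: outside [N[v]] and inside [A]. *)
have fy3 : 2 < f y.
  by have := f_lip (s := y) (t := u 4); rewrite e_sym eu4y fuE // ltnS; apply.
have fy5 : f y <= 5 by have := f_lip eu4y; rewrite fuE.
have fyr : f y < r by rewrite (leq_ltn_trans fy5) // le_r.
have [fry|nfy] := boolP (frozen e c y); last first.
  have r4 : 4 + (r - 4) = r by rewrite subnKC ?le_r.
  apply: (recolor_end_path (q := [seq u j | j <- iota 4 (r - 4).+1])
    (connect0 _ _) c_proper (erefl _) v_nonfrozen nfy).
  - rewrite /= e_sym eu4y; by apply: u_path; rewrite r4.
  - rewrite cons_uniq (@u_uniq 4 (r - 4).+1) ?addnS ?r4 // andbT.
    (* By its level [y] could only repeat [u 4] or [u 5], and it is neither. *)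
    apply/mapP=> -[j]; rewrite mem_iota addnS r4 => /andP[j4 jr] yE.
    move: fy5; rewrite yE f_u // => j5; move: y5 eu4y; rewrite yE.
    case: j j4 j5 {jr yE} => [|[|[|[|[|[|j]]]]]] // _ _; last by rewrite eqxx.
    by rewrite e_irr.
  - by rewrite /= u_last r4.
  - move=> t; rewrite inE => /predU1P[->|/mapP[j]].
      by rewrite f_in // ltnW.
    rewrite mem_iota addnS r4 => /andP[j4 jr] ->.
    by rewrite u_in // f_u // (leq_trans _ j4).
have N4 z : e (u 4) z -> z \in N[u 4] by rewrite in_closed_nbhd => ->; rewrite orbT.
have c4 s t : e (u 4) s -> e (u 4) t -> s != t -> c s != c t.
  by move=> es et; apply: contraNneq => /(frozen_inj fr4)->; rewrite ?N4.
have e43 : e (u 4) (u 3) by rewrite e_sym euE.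
have [eu2y|neu2y] := boolP (e (u 2) y).
  apply: (diamond 3 y) => //; first by rewrite e_sym.
    by apply/eqP; rewrite eqn_leq fy3 andbT; have := f_lip eu2y; rewrite fuE.
  exact: c4.
(* If adjacent to [u 3] and [u 5], [y] has level 4 and can replace its neighbor [u 4]. *)
have [/andP[eu3y eu5y]|] := boolP (e (u 3) y && e (u 5) y).
  apply: (diamond 4 y) => //; first by rewrite e_sym.
    apply/eqP; rewrite eqn_leq; have := f_lip eu3y; rewrite fuE // => -> /=.
    by have := f_lip (s := y) (t := u 5); rewrite e_sym eu5y fuE // ltnS; apply.
  by rewrite eq_sym; apply: (properP _ c_proper).
have y2 : y != u 2 by apply: contraTneq fy3 => ->; rewrite fuE.
(* The color of [u 2] is that of [u 5], which differs from that of [y] since both are neighbors of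
   [u 4]. *)
have cs : reach c (swap c (u 4) y).
  apply: (reach_swap_geodesic (i := 2) (s := u 2)); rewrite ?le_r ?euE ?fuE //.
  - exact: f_in.
  - by rewrite in_closed_nbhd negb_or y2.
  - by rewrite c25; apply: c4; rewrite ?euE // eq_sym.
(* Whichever of [u 3] and [u 5] is not adjacent to [y] sends the final token. *)
rewrite negb_and => /orP[ne3y|ne5y].
- apply: (recolor_end_swap (i := 3)) cs _ _ _ _ _ _ _ _;
    rewrite ?fuE ?euE ?le_r // 1?ltnW //.
  by rewrite in_closed_nbhd negb_or eq_sym y3 e_sym.
- apply: (recolor_end_swap (i := 5)) cs _ _ _ _ _ _ _ _;
    rewrite ?fuE ?euE ?le_r // 1?ltnW //; first by rewrite e_sym euE.
  by rewrite in_closed_nbhd negb_or eq_sym y5 e_sym.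
Qed.

End Geodesic.
End Reachability.

End Recoloring.

(** * Distances and their truncation *)

Section Distance.

Variables (T : finType) (e : rel T).

Lemma dist_leP x y k :
  reflect (exists p, [/\ path e x p, last x p = y & size p <= k])
          (dist_le e x y k).
Proof.
apply: (iffP existsP) => [[p /andP[xp /eqP py]]|[p [xp py pk]]].
  by exists p; split=> //; apply: size_bseq.
by exists (Bseq pk); rewrite /= xp py eqxx.
Qed.

Lemma dist_leW x y k l : k <= l -> dist_le e x y k -> dist_le e x y l.
Proof.
move=> kl /dist_leP[p [xp py pk]]; apply/dist_leP; exists p; split=> //.
exact: leq_trans kl.
Qed.

Lemma dist_leS x y z k : dist_le e x y k -> e y z -> dist_le e x z k.+1.
Proof.
case/dist_leP=> p [xp py pk] eyz; apply/dist_leP; exists (rcons p z); split.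
- by rewrite rcons_path xp py.
- by rewrite last_rcons.
- by rewrite size_rcons.
Qed.

(* The distance truncated at [r.+1], the value given to unreachable vertices. *)
Definition truncated_dist x r y := find (dist_le e x y) (iota 0 r.+1).

Lemma truncated_dist_le x r y j :
  j <= r -> (truncated_dist x r y <= j) = dist_le e x y j.
Proof.
move=> jr; apply/idP/idP => [dj|]; last first.
  move=> xyj; rewrite leqNgt; apply/negP=> /(before_find 0).
  by rewrite nth_iota // add0n xyj.
have h : has (dist_le e x y) (iota 0 r.+1).
  by rewrite has_find size_iota ltnS (leq_trans dj).
have := nth_find 0 h; rewrite nth_iota ?add0n; last by rewrite ltnS (leq_trans dj).
exact: dist_leW.
Qed.

Lemma truncated_dist_lip x r y z :
  e y z -> truncated_dist x r z <= (truncated_dist x r y).+1.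
Proof.
(* From level [r] on, the bound is the length [r.+1] of the searched list. *)
move=> eyz; have [dr|dr] := ltnP (truncated_dist x r y) r; last first.
  by rewrite (leq_trans (find_size _ _)) // size_iota ltnS.
rewrite truncated_dist_le //; apply: dist_leS eyz.
by rewrite -(@truncated_dist_le _ r) // ltnW.
Qed.

Lemma dist_eq_truncated x y r : dist_eq e x y r -> truncated_dist x r y = r.
Proof.
case/andP=> xyr /forallP far; apply/eqP; rewrite eqn_leq truncated_dist_le // xyr.
rewrite leqNgt; apply/negP=> dr; move/negP: (far (Ordinal dr)); apply.
by rewrite -(@truncated_dist_le _ r) //= ltnW.
Qed.

End Distance.

(** * Application to a shortest path from [v] to [w] *)

Theorem theorem4 (r : nat) (hr : 7 <= r) (T : finType) (e : rel T)
    (e_sym : symmetric e) (e_irr : irreflexive e)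
    (Delta : nat) (hmax : max_degree e = Delta) (hDelta : 3 <= Delta) :
  safe e Delta.+1 r.
Proof.
move=> v c pc nfv w vwr.
have deg_le x : #|nbhd e x| <= Delta by rewrite -hmax; apply: leq_bigmax.
have fw := dist_eq_truncated vwr.
set f := truncated_dist e v r in fw.
have f_lip s t : e s t -> f t <= (f s).+1 by apply: truncated_dist_lip.
have fv : f v = 0.
  apply/eqP; rewrite -leqn0 truncated_dist_le //.
  by apply/dist_leP; exists [::].
have /andP[/dist_leP[p [vp pw pr]] _] := vwr.
pose u i := nth v (v :: p) i.
have eu i : i < size p -> e (u i) (u i.+1) by move/(pathP v): vp; apply.
have f_incr i j : i + j <= size p -> f (u (i + j)) <= f (u i) + j.
  elim: j => [|j IH]; rewrite ?addn0 // addnS => ijp.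
  by rewrite addnS (leq_trans (f_lip _ _ (eu _ ijp))) // ltnS IH // ltnW.
have u_end : u (size p) = w by rewrite -pw (last_nth v).
(* Levels rise by at most one per edge, so reaching level [r] takes at least [r] edges. *)
have sp : size p = r.
  apply/eqP; rewrite eqn_leq pr /=.
  by have := f_incr 0 (size p); rewrite !add0n u_end fw /u /= fv; apply.
rewrite sp in eu f_incr u_end.
(* The upper bound counts edges from [v], the lower one edges to [w]. *)
have fu i : i <= r -> f (u i) = i.
  move=> ir; apply/eqP; rewrite eqn_leq.
  have := f_incr 0 i; rewrite !add0n {2}/u /= fv => -> //=.
  have := f_incr i (r - i); rewrite subnKC // u_end fw => /(_ (leqnn _)).
  by rewrite addnC -leq_subLR subKn.
have f_in z : f z < r -> z \in w |: ball e v r.-1.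
  move=> fz; rewrite !inE -(@truncated_dist_le _ e v r) ?leq_pred //.
  by rewrite -ltnS prednK ?fz ?orbT // (leq_ltn_trans _ hr).
have w_in : u r \in w |: ball e v r.-1 by rewrite u_end setU11.
have [d [/connectP[cs csp dE] dw dv]] := recolor_end e_sym e_irr deg_le f_lip f_in
  w_in fv fu eu (erefl _) pc nfv hDelta hr.
by exists cs; split; [exact: csp | rewrite -dE -u_end | rewrite -dE].
Qed.
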